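(* Let $a,b,c\in\mathbb{R}$, $\lambda>0$, $\alpha\in[0,1]$, and assume $l:=2a+b^2+\lambda c(2+c)<0$. Then the non compensated tamed Euler scheme with step size $\Delta t>0$ applied to the linear equation $dX(t)=aX(t^-)dt+bX(t^-)dW(t)+cX(t^-)dN(t)$, $X(0)=X_0$, that is, $$X_{n+1}=X_n+\frac{aX_n\Delta t}{1+\Delta t^\alpha|aX_n|}+bX_n\Delta W_n+cX_n\Delta N_n,$$ is mean-square stable if one of the following conditions is satisfied: (i) $a(1+\lambda c\Delta t)\le 0$, $2a-l>0$ and $\Delta t<\dfrac{2a-l}{a^2+\lambda^2c^2}$; (ii) $a(1+\lambda c\Delta t)>0$ and $\Delta t<\dfrac{-l}{(a+\lambda c)^2}$.
   Context: $W$ is a scalar Brownian motion and $N$ a scalar Poisson process with parameter $\lambda$, independent of each other and of $X_0$, where $X_0$ is a real random variable with $\mathbb{E}|X_0|^2<\infty$. $t_n=n\Delta t$, $\Delta W_n=W(t_{n+1})-W(t_n)$, $\Delta N_n=N(t_{n+1})-N(t_n)$. The scheme is called mean-square stable if (given $l<0$) $\lim_{n\to\infty}\mathbb{E}(X_n^2)=0$. *)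

(* Defs.v *)
From HB Require Import structures.
From mathcomp Require Import all_boot all_order all_algebra finmap.
From mathcomp Require Import all_classical all_reals all_analysis.
Set Implicit Arguments.
Unset Strict Implicit.
Unset Printing Implicit Defensive.
Import Order.TTheory GRing.Theory Num.Theory.
Import numFieldNormedType.Exports.
Local Open Scope classical_set_scope.
Local Open Scope ring_scope.

Section processes.
Context (d : measure_display) (T : measurableType d) (R : realType)
  (P : probability T R).

Definition mutually_independent (I : choiceType)
    (F : I -> set_system T) : Prop :=
  forall (J : {fset I}) (E : I -> set T),
    (forall i, i \in J -> F i (E i)) ->
    P (\bigcap_(i in [set` J]) E i) = (\prod_(i <- J) P (E i))%E.

(* A process is a family of random variables indexed by all reals, of which
   only the times in [0, +oo[ are ever constrained or used. *)
Definition process_sigma_algebra (Y : R -> {RV P >-> R}) : set_system T :=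
  <<s \bigcup_(t in `[0, +oo[) g_sigma_algebra_preimage (Y t) >>.

(* Stating this for infinite sequences of times is the same as for finite
   ones: mutual independence only involves finite subfamilies, and a finite
   sequence of times extends to a constant tail. *)
Definition independent_increments (Y : R -> {RV P >-> R}) : Prop :=
  forall t : nat -> R, 0 <= t 0%N -> {homo t : i j / (i <= j)%N >-> i <= j} ->
    mutually_independent
      (fun i => g_sigma_algebra_preimage (Y (t i.+1) \- Y (t i))).

(* The second parameter of normal_prob is the standard deviation. *)
Definition is_brownian_motion (W : R -> {RV P >-> R}) : Prop :=
  [/\ {ae P, forall w, W 0 w = 0},
      independent_increments W,
      (forall s t, 0 <= s -> s < t -> forall B, measurable B ->
         P ((W t \- W s) @^-1` B) = normal_prob 0 (Num.sqrt (t - s)) B) &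
      {ae P, forall w, {within `[0, +oo[, continuous (fun t => W t w)}}].

(* N is real-valued; the law of N t - N s forces its increments to be almost
   surely natural numbers. *)
Definition is_poisson_process (lambda : R) (N : R -> {RV P >-> R}) : Prop :=
  [/\ {ae P, forall w, N 0 w = 0},
      independent_increments N,
      (forall s t, 0 <= s -> s < t -> forall k : nat,
         P ((N t \- N s) @^-1` [set k%:R])
         = (poisson_pmf (lambda * (t - s)) k)%:E) &
      {ae P, forall w,
        (forall t, 0 <= t -> N x w @[x --> t^'+] --> N t w) /\
        (forall t, 0 < t -> cvg (N x w @[x --> t^'-]))}].

Definition independent_data (X0 : {RV P >-> R}) (W N : R -> {RV P >-> R}) :
    Prop :=
  mutually_independent (fun i : 'I_3 =>
    nth set0 [:: g_sigma_algebra_preimage X0;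
                 process_sigma_algebra W;
                 process_sigma_algebra N] i).

Fixpoint tamed_euler (a b c alpha dt : R) (X0 : T -> R) (W N : R -> T -> R)
    (n : nat) (w : T) : R :=
  if n is m.+1 then
    let x := tamed_euler a b c alpha dt X0 W N m w in
    x + a * x * dt / (1 + dt `^ alpha * `|a * x|)
      + b * x * (W (m.+1%:R * dt) w - W (m%:R * dt) w)
      + c * x * (N (m.+1%:R * dt) w - N (m%:R * dt) w)
  else X0 w.

Definition mean_square_stable (X : nat -> T -> R) : Prop :=
  ('E_P[(fun w => X n w ^+ 2)%R] @[n --> \oo] --> 0)%E.

End processes.

(* Main.v *)
From HB Require Import structures.
Require Import Defs.
From mathcomp Require Import all_boot all_order all_algebra finmap.
From mathcomp Require Import all_classical all_reals all_analysis.
From mathcomp Require Import measurable_realfun ring lra.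
Import Order.TTheory GRing.Theory Num.Theory.
Import numFieldNormedType.Exports.
Local Open Scope classical_set_scope.
Local Open Scope ring_scope.

(* X_n depends only on X_0 and on the first n increments of W and N, hence is
   independent of the next ones. Conditioning first on Delta N_n, then on
   Delta W_n, gives E[X_{n+1}^2] = E[K(tau) X_n^2], where
     K(tau) = (1 + a tau dt + lambda c dt)^2 + b^2 dt + lambda c^2 dt
   and tau = 1 / (1 + dt^alpha |a X_n|) lies in ]0, 1]. Expanding, K(tau) is
     1 + (l - 2a) dt + lambda^2 c^2 dt^2 + a^2 tau^2 dt^2
       + 2 a tau dt (1 + lambda c dt).
   In case (i) the last term is dropped, in case (ii) tau is replaced by 1; the
   bound on dt makes the result a constant rho < 1, so that
   E[X_n^2] <= rho^n E[X_0^2]. *)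

(** * Second moments of the normal law *)

(** The Radon-Nikodym derivative of the normal law equals [normal_pdf] almost everywhere, because
    both have the same integral over every measurable set. *)
Lemma ge0_integral_normal_prob (R : realType) (s : R) (f : _ -> \bar R) :
  s != 0 -> measurable_fun setT f -> (forall x, 0 <= f x)%E ->
  (\int[normal_prob 0 s]_x f x
   = \int[lebesgue_measure]_x (f x * (normal_pdf 0 s x)%:E))%E.
Proof.
move=> s0 mf f0.
have dom := normal_prob_dominates (0 : R) s.
rewrite -(Radon_Nikodym_SigmaFinite.change_of_variables dom)//.
have fi := Radon_Nikodym_SigmaFinite.f_integrable dom.
apply: ae_eq_integral => //.
- by apply: emeasurable_funM => //; exact: measurable_int fi.
- apply: emeasurable_funM => //.
  by apply/measurable_EFinP; exact: measurable_normal_pdf.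
apply: ae_eqe_mul2l; apply: integral_ae_eq => //.
- by apply/measurable_EFinP; exact: measurable_normal_pdf.
- by move=> E _ mE; rewrite -Radon_Nikodym_SigmaFinite.f_integral.
Qed.

(* The antiderivative that integration by parts of x * (x pdf(x)) produces. *)
Lemma is_derive_normal_pdf (R : realType) (s x : R) : s != 0 ->
  is_derive x 1 (fun y => - s ^+ 2 * y * normal_pdf 0 s y)
    ((x ^+ 2 - s ^+ 2) * normal_pdf 0 s x).
Proof.
move=> s0; rewrite normal_pdfE// /normal_fun.
set c := normal_peak s.
have -> : (fun y => - s ^+ 2 * y * (c * expR (- (y - 0) ^+ 2 / (s ^+ 2 *+ 2))))
  = (fun y => - s ^+ 2 * y * (c * expR (- y ^+ 2 / (s ^+ 2 *+ 2)))).
  by apply/funext => y; rewrite subr0.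
apply: is_derive_eq.
rewrite subr0 /GRing.scale/=.
move: (expR _) => E; rewrite -mulr_natl.
by field.
Qed.

(** Makes the boundary term of the integration by parts vanish at infinity. *)
Lemma cvg_mul_normal_pdf (R : realType) (s : R) : s != 0 ->
  n%:R * normal_pdf 0 s n%:R @[n --> \oo] --> (0 : R).
Proof.
move=> s0; rewrite -cvg_shiftS/=.
set c := normal_peak s * (s ^+ 2 *+ 2).
have s20 : 0 < s ^+ 2 *+ 2 by rewrite pmulrn_lgt0// exprn_even_gt0.
apply: (@squeeze_cvgr _ _ _ _ (cst 0) (fun n => c * harmonic n)); last 2 first.
- exact: cvg_cst.
- by rewrite -(mulr0 c); apply: cvgMr; exact: cvg_harmonic.
near=> n; rewrite mulr_ge0 ?normal_pdf_ge0//= normal_pdfE// /normal_fun subr0.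
rewrite /c -mulrA mulrCA ler_wpM2l ?normal_peak_ge0//.
rewrite mulNr expRN ler_pdivrMr ?expR_gt0//.
set t := n.+1%:R ^+ 2 / (s ^+ 2 *+ 2).
(* The bound comes from [t <= 1 + t <= expR t], after [n.+1] is written as a multiple of [t]. *)
rewrite [leLHS](_ : _ = s ^+ 2 *+ 2 / n.+1%:R * t).
  rewrite ler_wpM2l ?divr_ge0// ?(ltW s20)//.
  by rewrite (le_trans _ (expR_ge1Dx _))// lerDr.
have n0 : n.+1%:R != 0 :> R by rewrite pnatr_eq0.
have v0 : s ^+ 2 *+ 2 != 0 by rewrite gt_eqF.
by rewrite /t; move: (n.+1%:R) (s ^+ 2 *+ 2) n0 v0 => m v m0 v0; field; apply/andP.
Unshelve. all: by end_near. Qed.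

(** Integration by parts on [[0, n]] trades [x ^+ 2] for the constant [s ^+ 2] up to a boundary
    term; then [n] tends to infinity, and evenness passes from the half-line to the whole line. *)
Lemma integral_sqr_normal_pdf (R : realType) (s : R) : s != 0 ->
  (\int[lebesgue_measure]_x (x ^+ 2 * normal_pdf 0 s x)%:E = (s ^+ 2)%:E)%E.
Proof.
move=> s0; pose f (x : R) := x ^+ 2 * normal_pdf 0 s x.
have cpdf : continuous (normal_pdf (0 : R) s) by exact: continuous_normal_pdf.
have cf : continuous f.
  by move=> x; apply: cvgM; [exact: exprn_continuous|exact: cpdf].
have f0 x : 0 <= f x by rewrite mulr_ge0 ?sqr_ge0 ?normal_pdf_ge0.
have pdfN (x : R) : normal_pdf 0 s x = normal_pdf 0 s (- x).
  by rewrite normal_pdfE// /normal_fun !subr0 sqrrN.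
have cint (h : R -> R) n : continuous h ->
    lebesgue_measure.-integrable `[0, n%:R] (EFin \o h).
  move=> ch; apply: continuous_compact_integrable; first exact: segment_compact.
  exact: continuous_subspaceT.
pose F y := - s ^+ 2 * y * normal_pdf 0 s y.
have step n : (\int[lebesgue_measure]_(x in `[0%R, n%:R]) (f x)%:E =
    (F n%:R)%:E + (s ^+ 2)%:E *
      \int[lebesgue_measure]_(x in `[0%R, n%:R]) (normal_pdf 0 s x)%:E)%E.
  (* The fundamental theorem of calculus is applied on a nondegenerate interval, so [n = 0] is
     treated apart. *)
  have [->|n0] := eqVneq n 0%N.
    by rewrite set_itv1 !integral_set1 /F mulr0 mul0r mule0 adde0.
  rewrite -integralZl//=; last exact: cint.
  have dF x := is_derive_normal_pdf R s x s0.
  rewrite (_ : (F n%:R)%:E = (F n%:R)%:E - (F 0)%:E)%E; last first.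
    by rewrite /F mulr0 mul0r sube0.
  rewrite -(@continuous_FTC2 _ (fun x => (x ^+ 2 - s ^+ 2) * normal_pdf 0 s x)).
  - rewrite -integralD_EFin//.
    + by apply: eq_integral => x _; rewrite -EFinD -mulrDl subrK.
    + apply: cint => x; apply: cvgM; last exact: cpdf.
      by apply: cvgB; [exact: exprn_continuous|exact: cvg_cst].
    + by apply: cint => x; apply: cvgM; [exact: cvg_cst|exact: cpdf].
  - by rewrite ltr0n lt0n.
  - apply: continuous_subspaceT => x.
    apply: cvgM; last exact: cpdf.
    by apply: cvgB; [exact: exprn_continuous|exact: cvg_cst].
  - have cF x : F y @[y --> x] --> F x.
      by apply: differentiable_continuous; apply/derivable1_diffP; exact: ex_derive.
    split.
    + by move=> x _; exact: ex_derive.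
    + exact/cvg_at_right_filter/cF.
    + exact/cvg_at_left_filter/cF.
  - by move=> x _; rewrite derive1E; exact: derive_val.
have cI : (\int[lebesgue_measure]_(x in `[0%R, n%:R]) (f x)%:E @[n --> \oo] -->
    0%:E + (s ^+ 2)%:E *
      \int[lebesgue_measure]_(x in `[0%R, +oo[) (normal_pdf 0 s x)%:E)%E.
  rewrite (eq_cvg _ _ step); apply: cvgeD => //.
    rewrite /F (_ : (fun n => _) =
        (fun n => (- s ^+ 2 * (n%:R * normal_pdf 0 s n%:R))%:E)); last first.
      by apply/funext => n; rewrite mulrA.
    apply: cvg_EFin; first exact: nearW.
    have := cvg_mul_normal_pdf R s s0 => /(cvgM (cvg_cst (- s ^+ 2))).
    by rewrite mulr0.
  apply: cvgeZl => //; apply: ge0_cvgn_integral => //.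
  - exact: normal_pdf_ge0.
  - exact: measurable_normal_pdf.
(* The integrals of [f] over [[0, n]] also tend to its integral over the half-line; limits are
   unique. *)
have I0 : (\int[lebesgue_measure]_(x in `[0%R, +oo[) (f x)%:E =
  (s ^+ 2)%:E *
    \int[lebesgue_measure]_(x in `[0%R, +oo[) (normal_pdf 0 s x)%:E)%E.
  rewrite -[RHS]add0e; apply: cvg_unique cI => //; apply: ge0_cvgn_integral => //.
  exact: continuous_measurable_fun.
have setE : [set x : R | 0 <= x] = `[0, +oo[%classic.
  by apply/seteqP; split => x /=; rewrite in_itv/= andbT.
rewrite ge0_symfun_integralT//; last first.
  by move=> x; rewrite /= sqrrN -pdfN.
rewrite setE I0 muleCA -setE -ge0_symfun_integralT//.
- by rewrite integral_normal_pdf mule1.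
- exact: normal_pdf_ge0.
Qed.

(* Adding the integral to its image under x -> -x removes the linear term while
   all integrands stay nonnegative, so integrability never has to be shown. *)
Lemma integral_affine_sqr_even (R : realType) (f : R -> R) (v p q : R) :
  measurable_fun setT f -> (forall x, 0 <= f x) -> (forall x, f (- x) = f x) ->
  (\int[lebesgue_measure]_x (f x)%:E = 1)%E ->
  (\int[lebesgue_measure]_x (x ^+ 2 * f x)%:E = v%:E)%E ->
  (\int[lebesgue_measure]_x ((p + q * x) ^+ 2 * f x)%:E
   = (p ^+ 2 + q ^+ 2 * v)%:E)%E.
Proof.
move=> mf f0 fN intf intx2f.
pose h x := (p + q * x) ^+ 2 * f x; pose g (x : R) := x ^+ 2 * f x.
have mh : measurable_fun setT (EFin \o h).
  apply/measurable_EFinP/measurable_funM => //; apply: measurable_funX.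
  by apply: measurable_funD => //; exact: measurable_funM.
have mg : measurable_fun setT (EFin \o g).
  by apply/measurable_EFinP/measurable_funM => //; exact: measurable_funX.
have mEf : measurable_fun setT (EFin \o f) by exact/measurable_EFinP.
have h0 x : (0 <= (EFin \o h) x)%E by rewrite lee_fin mulr_ge0 ?sqr_ge0.
have g0 x : (0 <= (EFin \o g) x)%E by rewrite lee_fin mulr_ge0 ?sqr_ge0.
have Ef0 x : (0 <= (EFin \o f) x)%E by rewrite lee_fin.
have mhN : measurable_fun setT (EFin \o h \o -%R) by exact: measurableT_comp.
(* Lebesgue measure is invariant under reflection. *)
have hN : (\int[lebesgue_measure]_x (EFin \o h) x =
    \int[lebesgue_measure]_x (EFin \o h \o -%R) x)%E.
  transitivity (\int[pushforward lebesgue_measure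
      (-%R : _ -> measurableTypeR R)]_x (EFin \o h) x)%E.
    by apply: eq_measure_integral => A mA _; apply/esym/lebesgue_measureN.
  by rewrite ge0_integral_pushforward.
have hD x : h x + h (- x) = 2 * p ^+ 2 * f x + 2 * q ^+ 2 * g x.
  by rewrite /h /g fN; move: (f x) => y; ring.
have p20 : 0 <= 2 * p ^+ 2 by rewrite mulr_ge0 ?sqr_ge0.
have q20 : 0 <= 2 * q ^+ 2 by rewrite mulr_ge0 ?sqr_ge0.
have I2 : (\int[lebesgue_measure]_x (EFin \o h) x
    + \int[lebesgue_measure]_x (EFin \o h) x
    = (2 * (p ^+ 2 + q ^+ 2 * v))%:E)%E.
  rewrite {2}hN -ge0_integralD//; last by move=> x _; exact: h0.
  transitivity (\int[lebesgue_measure]_x ((2 * p ^+ 2)%:E * (EFin \o f) x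
      + (2 * q ^+ 2)%:E * (EFin \o g) x))%E.
    by apply: eq_integral => x _; rewrite /= -!EFinM -!EFinD hD.
  rewrite ge0_integralD//; last 4 first.
  - by move=> x _; rewrite mule_ge0.
  - exact: measurable_funeM.
  - by move=> x _; rewrite mule_ge0.
  - exact: measurable_funeM.
  rewrite !ge0_integralZl_EFin// intf intx2f mule1 -EFinM -EFinD.
  by congr _%:E; ring.
have I0 : (0 <= \int[lebesgue_measure]_x (EFin \o h) x)%E by exact: integral_ge0.
rewrite [LHS](_ : _ = \int[lebesgue_measure]_x (EFin \o h) x)%E//.
(* Halving [I2] needs a finite value: [+oo] contradicts [I2], and [-oo] contradicts [I0]. *)
by case: integral I0 I2 => [r _ [rr]|_|]//; congr _%:E; lra.
Qed.

Lemma integral_affine_sqr_normal_prob (R : realType) (s p q : R) : s != 0 ->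
  (\int[normal_prob 0 s]_x ((p + q * x) ^+ 2)%:E
   = (p ^+ 2 + q ^+ 2 * s ^+ 2)%:E)%E.
Proof.
move=> s0; rewrite ge0_integral_normal_prob//.
- under eq_integral do rewrite -EFinM.
  apply: integral_affine_sqr_even.
  + exact: measurable_normal_pdf.
  + exact: normal_pdf_ge0.
  + by move=> x; rewrite normal_pdfE// /normal_fun !subr0 sqrrN.
  + exact: integral_normal_pdf.
  + exact: integral_sqr_normal_pdf.
- apply/measurable_EFinP/measurable_funX.
  by apply: measurable_funD => //; exact: measurable_funM.
- by move=> x; rewrite lee_fin sqr_ge0.
Qed.

(** * Second moments of the Poisson law *)

(* Write (p + q k)^2 = p^2 + (2 p q + q^2) k + q^2 k (k - 1) and absorb the
   factors k and k (k - 1) in the factorial. *)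
Lemma series_affine_sqr_exp_coeff (R : realType) (r p q : R) (n : nat) :
  series (fun k => (p + q * k%:R) ^+ 2 * exp_coeff r k) n.+2 =
    p ^+ 2 * series (exp_coeff r) n.+2
    + (2 * p * q + q ^+ 2) * r * series (exp_coeff r) n.+1
    + q ^+ 2 * r ^+ 2 * series (exp_coeff r) n.
Proof.
elim: n => [|n IH].
  rewrite /series /= !big_nat_recr//= !big_geq//= /exp_coeff/= !factS fact0.
  by rewrite !expr0 !expr1 !invr1; ring.
have eS k : exp_coeff r k.+1 = exp_coeff r k * r / k.+1%:R.
  rewrite /exp_coeff/= factS natrM exprSr invfM; ring.
rewrite !(seriesSr _ n.+2) IH (seriesSr _ n.+1) (seriesSr _ n) !eS.
have n1 : n%:R + 1 != 0 :> R by rewrite natr1 pnatr_eq0.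
have n2 : n%:R + 2 != 0 :> R by rewrite -natrD addn2 pnatr_eq0.
rewrite -(addn2 n) -(addn1 n) !natrD.
move: (n%:R) (exp_coeff r n) (series _ _) n1 n2 => m e s n1 n2.
by field; rewrite n1.
Qed.

(** After a shift by 2, each of the three partial sums of the exponential series tends to [expR r],
    which cancels [expR (- r)]. *)
Lemma cvg_series_affine_sqr_poisson_pmf (R : realType) (r p q : R) : 0 < r ->
  series (fun k => (p + q * k%:R) ^+ 2 * poisson_pmf r k) @ \oo -->
    (p + q * r) ^+ 2 + q ^+ 2 * r.
Proof.
move=> r0.
have -> : series (fun k => (p + q * k%:R) ^+ 2 * poisson_pmf r k) =
    (fun n => expR (- r) * series (fun k => (p + q * k%:R) ^+ 2 * exp_coeff r k) n).
  apply/funext => n; rewrite /series/= big_distrr/=; apply: eq_bigr => k _.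
  by rewrite /poisson_pmf r0 /exp_coeff /=; ring.
rewrite -(cvg_shiftn 2).
under eq_fun do rewrite addn2 series_affine_sqr_exp_coeff.
have cE : series (exp_coeff r) @ \oo --> expR r.
  exact: is_cvg_series_exp_coeff.
have cE1 : series (exp_coeff r) n.+1 @[n --> \oo] --> expR r by rewrite cvg_shiftS.
have cE2 : series (exp_coeff r) n.+2 @[n --> \oo] --> expR r.
  by rewrite (cvg_shiftS (fun n => series (exp_coeff r) n.+1)).
rewrite (_ : _ + _ = expR (- r) * (p ^+ 2 * expR r
    + (2 * p * q + q ^+ 2) * r * expR r + q ^+ 2 * r ^+ 2 * expR r)).
  by apply: cvgM; [exact: cvg_cst|apply: cvgD; [apply: cvgD|]];
    apply: cvgM => //; exact: cvg_cst.
rewrite expRN; have := expR_gt0 r; move: (expR r) => e /gt_eqF/negbT e0.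
by field.
Qed.

(** The prescribed masses at the naturals add up to 1, so [Z] is almost surely a natural number and
    the integral becomes a series over its values. *)
Lemma integral_affine_sqr_poisson d (T : measurableType d) (R : realType)
    (P : probability T R) (Z : {RV P >-> R}) (r p q : R) : 0 < r ->
  (forall k : nat, P (Z @^-1` [set k%:R]) = (poisson_pmf r k)%:E) ->
  (\int[P]_w ((p + q * Z w) ^+ 2)%:E = ((p + q * r) ^+ 2 + q ^+ 2 * r)%:E)%E.
Proof.
move=> r0 PZ; pose F k : set T := Z @^-1` [set k%:R].
have mF k : measurable (F k).
  by rewrite -[F k]setTI; apply: (measurable_funPT Z) => //; exact: measurable_set1.
have tF : trivIset setT F.
  move=> i j _ _ [w []]; rewrite /F /= => -> /eqP.
  by rewrite eqr_nat => /eqP.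
have seriesE (a b : R) :
    (\sum_(k <oo) ((a + b * k%:R) ^+ 2 * poisson_pmf r k)%:E
     = ((a + b * r) ^+ 2 + b ^+ 2 * r)%:E)%E.
  apply/cvg_lim => //.
  rewrite (_ : (fun n => _) =
      EFin \o series (fun k => (a + b * k%:R) ^+ 2 * poisson_pmf r k)).
    by apply: cvg_EFin; [exact: nearW|exact: cvg_series_affine_sqr_poisson_pmf].
  by apply/funext => n; rewrite /series/= sumEFin.
have mUF : measurable (\bigcup_k F k) by exact: bigcupT_measurable.
have PUF : P (\bigcup_k F k) = 1%E.
  rewrite measure_semi_bigcup//.
  (* The total mass is the case of the constant function 1. *)
  have := seriesE 1 0; rewrite !mul0r addr0 expr1n expr0n/= mul0r addr0 => <-.
  by apply: eq_eseriesr => k _; rewrite mul0r addr0 expr1n mul1r PZ.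
have PCF : P (~` \bigcup_k F k) = 0%E.
  by rewrite probability_setC// PUF subee.
have mf : measurable_fun setT (fun w => ((p + q * Z w) ^+ 2)%:E).
  apply/measurable_EFinP/measurable_funX; apply: measurable_funD => //.
  exact: measurable_funM.
rewrite (@ge0_negligible_integral _ _ _ P _ (~` \bigcup_k F k))//; last 2 first.
- exact: measurableC.
- by move=> w _; rewrite lee_fin sqr_ge0.
rewrite setTD setCK ge0_integral_bigcup//; last 2 first.
- exact: measurable_funTS.
- by move=> w _; rewrite lee_fin sqr_ge0.
rewrite -seriesE; apply: eq_eseriesr => k _.
rewrite (@eq_integral _ _ _ _ _ (cst ((p + q * k%:R) ^+ 2)%:E)); last first.
  by move=> w; rewrite inE /F/= => ->.
by rewrite integral_cst// [RHS]EFinM; congr (_ * _)%E; exact: PZ.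
Qed.

(** * Independence *)

(** A measure on the product is determined by its values on rectangles, so the joint law is the
    product of the laws; Tonelli then applies. *)
Lemma ge0_integral_independent d d1 d2 (T : measurableType d)
    (T1 : measurableType d1) (T2 : measurableType d2) (R : realType)
    (P : probability T R) (Y : {RV P >-> T1}) (Z : {RV P >-> T2})
    (f : T1 * T2 -> \bar R) :
  (forall A B, measurable A -> measurable B ->
    P (Y @^-1` A `&` Z @^-1` B) = P (Y @^-1` A) * P (Z @^-1` B))%E ->
  measurable_fun setT f -> (forall x, 0 <= f x)%E ->
  (\int[P]_w f (Y w, Z w) = \int[P]_v \int[P]_w f (Y v, Z w))%E.
Proof.
move=> indep mf f0.
pose YZ : T -> T1 * T2 := fun w => (Y w, Z w).
have mYZ : measurable_fun setT YZ by exact: measurable_fun_pair.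
pose q : {mfun T >-> (T1 * T2)%type} :=
  HB.pack YZ (isMeasurableFun.Build _ _ _ _ YZ mYZ).
rewrite (_ : (\int[P]_w _ = \int[distribution P q]_z f z)%E); last first.
  by rewrite ge0_integral_distribution.
rewrite (eq_measure_integral (distribution P Y \x distribution P Z)%E); last first.
  by move=> A mA _; apply/esym; exact: product_measure_unique.
rewrite fubini_tonelli1// /fubini_F ge0_integral_distribution//; last 2 first.
- exact: measurable_fun_fubini_tonelli_F.
- by move=> y; apply: integral_ge0.
apply: eq_integral => v _ /=; rewrite ge0_integral_distribution//.
exact: measurableT_comp.
Qed.

(** Stands in for conditioning on the sigma-algebra generated by [G]: [Z] is integrated out with [U]
    and [V] frozen. The numbers [m] and [v] are the mean and variance of [Z]. *)
Lemma integral_affine_sqr_independent d (T : measurableType d) (R : realType)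
    (P : probability T R) (G : set_system T) (U V : T -> R) (Z : {RV P >-> R})
    (m v : R) :
  G `<=` measurable ->
  measurable_fun [set: g_sigma_algebraType G] U ->
  measurable_fun [set: g_sigma_algebraType G] V ->
  (forall A B, <<s G >> A -> measurable B ->
    P (A `&` Z @^-1` B) = P A * P (Z @^-1` B))%E ->
  (forall p q : R, \int[P]_w ((p + q * Z w) ^+ 2)%:E
    = ((p + q * m) ^+ 2 + q ^+ 2 * v)%:E)%E ->
  (\int[P]_w ((U w + V w * Z w) ^+ 2)%:E
   = \int[P]_w ((U w + V w * m) ^+ 2 + V w ^+ 2 * v)%:E)%E.
Proof.
move=> Gm mU mV indep mom.
(* U and V become functions of the identity into T with the smaller
   sigma-algebra, to which Fubini applies. *)
pose Y : T -> g_sigma_algebraType G := id.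
have mY : measurable_fun [set: T] Y.
  move=> _ A mA; rewrite setTI.
  exact: (smallest_sub (@sigma_algebra_measurable _ T) Gm).
pose q : {RV P >-> g_sigma_algebraType G} :=
  HB.pack Y (isMeasurableFun.Build _ _ _ _ Y mY).
pose f (x : g_sigma_algebraType G * R) := ((U x.1 + V x.1 * x.2) ^+ 2)%:E.
have mf : measurable_fun setT f.
  apply/measurable_EFinP/measurable_funX; apply: measurable_funD.
    exact: measurableT_comp.
  by apply: measurable_funM => //; exact: measurableT_comp.
have := @ge0_integral_independent _ _ _ _ _ _ _ P q Z f => ->//.
- by apply: eq_integral => w _; rewrite -mom.
- by move=> x; rewrite lee_fin sqr_ge0.
Qed.

(** * Cylinder sets of a sequence of increments *)

Lemma bigcap_ltnS (T : Type) (F : nat -> set T) (n : nat) :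
  \bigcap_(i < n.+1) F i = \bigcap_(i < n) F i `&` F n.
Proof. by rewrite !bigcap_mkord big_ord_recr. Qed.

Lemma perm_eq_fset_ltn (n : nat) :
  perm_eq [fset i in index_iota 0 n]%fset (index_iota 0 n).
Proof.
by apply: uniq_perm; [exact: fset_uniq|exact: iota_uniq|move=> i; rewrite in_fset].
Qed.

(** A pi-system generating the sigma-algebra of the first [n] terms of [D]; the sets [B i] with
    [i >= n] are irrelevant. *)
Definition cylinder_sets {T : Type} {R : realType} (D : nat -> T -> R) (n : nat) :
    set_system T :=
  [set A | exists2 B : nat -> set R, (forall i, measurable (B i)) &
     A = \bigcap_(i < n) D i @^-1` B i].

Section cylinder_sets.
Context {T : Type} {R : realType}.
Implicit Types (D : nat -> T -> R) (n : nat).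

Lemma cylinder_setsI D n : setI_closed (cylinder_sets D n).
Proof.
move=> _ _ [B mB ->] [C mC ->]; exists (fun i => B i `&` C i).
  by move=> i; exact: measurableI.
by rewrite -bigcapI.
Qed.

Lemma cylinder_setsT D n : cylinder_sets D n setT.
Proof.
exists (fun=> setT); first by move=> _; exact: measurableT.
by apply/esym; apply: bigcapT => i _; rewrite preimage_setT.
Qed.

Lemma cylinder_setsS D n (A : set T) (B : set R) :
  cylinder_sets D n A -> measurable B ->
  cylinder_sets D n.+1 (A `&` D n @^-1` B).
Proof.
(* [C n] is not constrained by the old cylinder, so it may be overwritten. *)
move=> [C mC ->] mB; exists (fun i => if i == n then B else C i).
  by move=> i; case: ifP.
rewrite bigcap_ltnS eqxx; congr (_ `&` _).
by apply: eq_bigcapr => i /=; rewrite ltn_neqAle => /andP[/negbTE ->].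
Qed.

Lemma cylinder_sets_preimage D n i (B : set R) : (i < n)%N -> measurable B ->
  cylinder_sets D n (D i @^-1` B).
Proof.
move=> ni mB; exists (fun j => if j == i then B else setT).
  by move=> j; case: ifP.
apply/seteqP; split => w /= => [Bw j _|/(_ i ni)/=]; last by rewrite eqxx.
by case: ifPn => // /eqP ->.
Qed.

End cylinder_sets.

Lemma measurable_cylinder_sets d (T : measurableType d) (R : realType)
    (D : nat -> T -> R) (n : nat) :
  (forall i, measurable_fun setT (D i)) -> cylinder_sets D n `<=` measurable.
Proof.
move=> mD _ [B mB ->]; apply: fin_bigcap_measurable; first exact: finite_II.
by move=> i _; rewrite -[X in measurable X]setTI; exact: mD.
Qed.

Section increments.
Context {d} {T : measurableType d} {R : realType} {P : probability T R}.
Variables (Y : R -> {RV P >-> R}) (dt : R).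
Hypotheses (dt0 : 0 <= dt).

Let D i : T -> R := Y (i.+1%:R * dt) \- Y (i%:R * dt).

(** Lets [independent_data], which speaks of whole processes, be applied to increments on the
    grid. *)
Lemma process_sigma_algebra_cylinder n :
  cylinder_sets D n `<=` process_sigma_algebra Y.
Proof.
set G := \bigcup_(t in `[0, +oo[) g_sigma_algebra_preimage (Y t).
apply: (@measurable_cylinder_sets _ (g_sigma_algebraType G)) => i.
have mY k : measurable_fun [set: g_sigma_algebraType G] (Y (k%:R * dt)).
  move=> _ B mB; apply: sub_sigma_algebra; exists (k%:R * dt).
    by rewrite /= in_itv/= andbT mulr_ge0.
  by exists B.
exact: measurable_funB.
Qed.

Lemma independent_increments_cylinder n (A : set T) (B : set R) :
  independent_increments Y -> cylinder_sets D n A -> measurable B ->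
  P (A `&` D n @^-1` B) = (P A * P (D n @^-1` B))%E.
Proof.
move=> indepY [C mC ->] mB.
(* One family serves both factorizations: its first [n] sets give the cylinder, and its first [n.+1]
   sets add the new increment. *)
pose E i := D i @^-1` (if i == n then B else C i).
have PE k : P (\bigcap_(i < k) E i) = (\prod_(i < k) P (E i))%E.
  have t0 : 0 <= 0%:R * dt by rewrite mul0r.
  have tle : {homo (fun i : nat => i%:R * dt) : i j / (i <= j)%N >-> i <= j}.
    by move=> i j ij; rewrite ler_wpM2r// ler_nat.
  have := indepY (fun i => i%:R * dt) t0 tle [fset i in index_iota 0 k]%fset E.
  rewrite (perm_big _ (perm_eq_fset_ltn k)) big_mkord => <-.
    rewrite (_ : [set` _] = `I_k)//.
    by apply/seteqP; split => i /=; rewrite in_fset/= mem_index_iota.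
  move=> i _; rewrite /E; case: ifP => _; [exists B|exists (C i)] => //;
    by rewrite setTI.
rewrite (_ : \bigcap_(i < n) D i @^-1` C i = \bigcap_(i < n) E i); last first.
  by apply: eq_bigcapr => i /=; rewrite /E ltn_neqAle => /andP[/negbTE ->].
rewrite (_ : D n @^-1` B = E n); last by rewrite /E eqxx.
by rewrite -bigcap_ltnS !PE big_ord_recr.
Qed.

End increments.

Lemma independent_data_prob d (T : measurableType d) (R : realType)
    (P : probability T R) (X0 : {RV P >-> R}) (W N : R -> {RV P >-> R})
    (A0 A1 A2 : set T) :
  independent_data X0 W N -> g_sigma_algebra_preimage X0 A0 ->
  process_sigma_algebra W A1 -> process_sigma_algebra N A2 ->
  P (A0 `&` A1 `&` A2) = (P A0 * P A1 * P A2)%E.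
Proof.
move=> indep h0 h1 h2.
pose J := [fset i in index_enum 'I_3]%fset.
have JE : perm_eq J (index_enum 'I_3).
  apply: uniq_perm; [exact: fset_uniq|exact: index_enum_uniq|].
  by move=> i; rewrite in_fset.
have := indep J (fun i => nth set0 [:: A0; A1; A2] i).
rewrite bigcap_fset !(perm_big _ JE)/= !big_ord_recl !big_ord0/=.
rewrite setIT mule1 setIA muleA; apply => i _.
by case: i => -[|[|[|//]]] /=.
Qed.

(** The finite measures sending [A] to [P (A]&[D)] and to [P A * P D] agree on a pi-system
    containing the whole space, hence on the sigma-algebra it generates. *)
Lemma sigma_algebra_independent d (T : measurableType d) (R : realType)
    (P : probability T R) (G : set_system T) (D : set T) :
  G `<=` measurable -> setI_closed G -> G setT -> measurable D ->
  (forall A, G A -> P (A `&` D) = P A * P D)%E ->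
  (forall A, <<s G >> A -> P (A `&` D) = P A * P D)%E.
Proof.
move=> Gm GI GT mD GD A sA.
have PDfin : P D \is a fin_num by exact: fin_num_measure.
pose r : {nonneg R} := NngNum (fine_ge0 (measure_ge0 P D)).
have rE B : mscale r P B = (P B * P D)%E by rewrite /mscale muleC fineK.
rewrite -rE.
apply: (g_sigma_algebra_measure_unique G Gm (fun=> setT) _ _ (mrestr P mD)) sA => //.
- by apply/seteqP; split => // x _; exists 0%N.
- by move=> B GB; rewrite [RHS]rE; exact: GD.
- move=> _; suff : (P ([set: T] `&` D) < +oo)%E by [].
  by rewrite setTI ltey_eq PDfin.
Qed.

(** * The past of the scheme and its independence of the next increments *)

Section past.
Context {d} {T : measurableType d} {R : realType} {P : probability T R}.
Variables (X0 : {RV P >-> R}) (W N : R -> {RV P >-> R}) (dt : R).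
Hypotheses (dt0 : 0 <= dt) (indep : independent_data X0 W N).
Hypotheses (indepW : independent_increments W).
Hypotheses (indepN : independent_increments N).

Let DW i : T -> R := W (i.+1%:R * dt) \- W (i%:R * dt).
Let DN i : T -> R := N (i.+1%:R * dt) \- N (i%:R * dt).

(* A pi-system generating the sigma-algebra of X_0, of the first n increments of
   W and of the first m increments of N. The two counts are separate because the
   one-step argument needs n + 1 increments of W but only n of N. *)
Definition past_sets (n m : nat) : set_system T :=
  [set A | exists A0 A1 A2, [/\ g_sigma_algebra_preimage X0 A0,
     cylinder_sets DW n A1, cylinder_sets DN m A2 &
     A = A0 `&` A1 `&` A2]].

Let preimageT : g_sigma_algebra_preimage X0 setT.
Proof. by exists setT => //; rewrite preimage_setT setTI. Qed.

Lemma past_setsI n m : setI_closed (past_sets n m).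
Proof.
move=> A C [A0 [A1 [A2 [[B0 mB0 <-] hA1 hA2 ->]]]].
move=> [C0 [C1 [C2 [[D0 mD0 <-] hC1 hC2 ->]]]].
exists (X0 @^-1` (B0 `&` D0)), (A1 `&` C1), (A2 `&` C2).
split; [|exact: cylinder_setsI|exact: cylinder_setsI|].
  by exists (B0 `&` D0); [exact: measurableI|rewrite setTI].
by rewrite !setTI preimage_setI setIACA; congr (_ `&` _); rewrite setIACA.
Qed.

Lemma past_setsT n m : past_sets n m setT.
Proof.
by exists setT, setT, setT; rewrite !setIT; split => //; exact: cylinder_setsT.
Qed.

Lemma measurable_past_sets n m : past_sets n m `<=` measurable.
Proof.
move=> _ [A0 [A1 [A2 [[B0 mB0 <-] hA1 hA2 ->]]]].
apply: measurableI; first apply: measurableI.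
- exact: measurable_funPT.
- by apply: measurable_cylinder_sets hA1 => i; exact: measurable_funB.
- by apply: measurable_cylinder_sets hA2 => i; exact: measurable_funB.
Qed.

Lemma measurable_past_initial n m :
  measurable_fun [set: g_sigma_algebraType (past_sets n m)] X0.
Proof.
move=> _ B mB; rewrite setTI; apply: sub_sigma_algebra.
exists (X0 @^-1` B), setT, setT; rewrite !setIT.
split=> //; [|exact: cylinder_setsT|exact: cylinder_setsT].
by exists B => //; rewrite setTI.
Qed.

Lemma measurable_past_W n m i : (i < n)%N ->
  measurable_fun [set: g_sigma_algebraType (past_sets n m)] (DW i).
Proof.
move=> ni _ B mB; rewrite setTI; apply: sub_sigma_algebra.
exists setT, (DW i @^-1` B), setT; rewrite setIT setTI.
split=> //; [exact: cylinder_sets_preimage|exact: cylinder_setsT].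
Qed.

Lemma measurable_past_N n m i : (i < m)%N ->
  measurable_fun [set: g_sigma_algebraType (past_sets n m)] (DN i).
Proof.
move=> mi _ B mB; rewrite setTI; apply: sub_sigma_algebra.
exists setT, setT, (DN i @^-1` B); rewrite !setTI.
split=> //; [exact: cylinder_setsT|exact: cylinder_sets_preimage].
Qed.

Let past_measure A0 A1 A2 n m :
  g_sigma_algebra_preimage X0 A0 -> cylinder_sets DW n A1 ->
  cylinder_sets DN m A2 -> P (A0 `&` A1 `&` A2) = (P A0 * P A1 * P A2)%E.
Proof.
move=> h0 h1 h2; apply: independent_data_prob indep h0 _ _.
- exact: process_sigma_algebra_cylinder h1.
- exact: process_sigma_algebra_cylinder h2.
Qed.

Lemma past_independent_W n m (A : set T) (B : set R) :
  <<s past_sets n m >> A -> measurable B ->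
  P (A `&` DW n @^-1` B) = (P A * P (DW n @^-1` B))%E.
Proof.
move=> sA mB; move: A sA; apply: sigma_algebra_independent.
- exact: measurable_past_sets.
- exact: past_setsI.
- exact: past_setsT.
- by rewrite -[X in measurable X]setTI; exact: measurable_funB.
move=> _ [A0 [A1 [A2 [h0 h1 h2 ->]]]].
(* The new increment is merged with [A1] into a cylinder of length [n.+1]. Independence of the three
   sources isolates it, and independence of the increments of [W] then splits it. *)
rewrite (setIAC (A0 `&` A1)) -(setIA A0 A1 (DW n @^-1` B)).
rewrite (past_measure _ _ _ n.+1 m)//; last exact: cylinder_setsS.
rewrite (past_measure _ _ _ n m)// independent_increments_cylinder//.
by rewrite muleA [LHS]muleAC.
Qed.

Lemma past_independent_N n m (A : set T) (B : set R) :
  <<s past_sets n m >> A -> measurable B ->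
  P (A `&` DN m @^-1` B) = (P A * P (DN m @^-1` B))%E.
Proof.
move=> sA mB; move: A sA; apply: sigma_algebra_independent.
- exact: measurable_past_sets.
- exact: past_setsI.
- exact: past_setsT.
- by rewrite -[X in measurable X]setTI; exact: measurable_funB.
move=> _ [A0 [A1 [A2 [h0 h1 h2 ->]]]].
rewrite -(setIA (A0 `&` A1)) (past_measure _ _ _ n m.+1)//; last exact: cylinder_setsS.
rewrite (past_measure _ _ _ n m)// independent_increments_cylinder//.
by rewrite !muleA.
Qed.

End past.

(** * The tamed Euler scheme *)

Section increment_RV.
Context {d} {T : measurableType d} {R : realType} {P : probability T R}.
Variables (Y : R -> {RV P >-> R}) (s t : R).

Let measurable_increment : measurable_fun setT (Y t \- Y s).
Proof. exact: measurable_funB. Qed.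

(** Bundled because the independence lemma takes a random variable, not a bare function. *)
Definition increment_RV : {RV P >-> R} :=
  HB.pack (Y t \- Y s) (isMeasurableFun.Build _ _ _ _ _ measurable_increment).

End increment_RV.

(** The term [q * 0] is kept so that the identity has the form of the moment hypothesis above, with
    mean 0 and variance [t - s]. *)
Lemma integral_affine_sqr_brownian d (T : measurableType d) (R : realType)
    (P : probability T R) (W : R -> {RV P >-> R}) (s t p q : R) :
  is_brownian_motion W -> 0 <= s -> s < t ->
  (\int[P]_w ((p + q * (W t \- W s) w) ^+ 2)%:E
   = ((p + q * 0) ^+ 2 + q ^+ 2 * (t - s))%:E)%E.
Proof.
move=> [_ _ lawW _] s0 st.
have ts0 : 0 < t - s by rewrite subr_gt0.
pose f (x : R) := ((p + q * x) ^+ 2)%:E.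
have mf : measurable_fun setT f.
  apply/measurable_EFinP/measurable_funX.
  by apply: measurable_funD => //; exact: measurable_funM.
have f0 x : (0 <= f x)%E by rewrite lee_fin sqr_ge0.
(* [normal_prob] is a measure on [measurableTypeR R], whose display is not that
   of [R]. *)
pose Z : T -> measurableTypeR R := W t \- W s.
have mZ : measurable_fun setT Z by exact: measurable_funB.
pose D : {RV P >-> measurableTypeR R} :=
  HB.pack Z (isMeasurableFun.Build _ _ _ _ Z mZ).
transitivity (\int[distribution P D]_x f x)%E.
  by rewrite ge0_integral_distribution.
rewrite (eq_measure_integral (normal_prob 0 (Num.sqrt (t - s)))); last first.
  by move=> A mA _; exact: lawW.
rewrite integral_affine_sqr_normal_prob; last by rewrite gt_eqF// sqrtr_gt0.
by rewrite mulr0 addr0 sqr_sqrtr// ltW.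
Qed.

(** The denominator is at least 1, so the map is continuous; [r] stands for the power of the step
    size. *)
Lemma measurable_tamed_drift (R : realType) (a r dt : R) : 0 <= r ->
  measurable_fun [set: R] (fun x => x + a * x * dt / (1 + r * `|a * x|)).
Proof.
move=> r0; apply: continuous_measurable_fun => x.
apply: cvgD; first exact: cvg_id.
apply: cvgM.
  by apply: cvgM; [apply: cvgM; [exact: cvg_cst|exact: cvg_id]|exact: cvg_cst].
apply: cvgV; first by rewrite gt_eqF// ltr_wpDr// mulr_ge0.
apply: cvgD; first exact: cvg_cst.
apply: cvgM; first exact: cvg_cst.
by apply: cvg_norm; apply: cvgM; [exact: cvg_cst|exact: cvg_id].
Qed.

Lemma tamed_growth_factor (R : realFieldType) (a b c lambda dt : R) :
  let l := 2 * a + b ^+ 2 + lambda * c * (2 + c) in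
  0 < lambda -> 0 < dt ->
  ([/\ a * (1 + lambda * c * dt) <= 0, 0 < 2 * a - l
     & dt < (2 * a - l) / (a ^+ 2 + lambda ^+ 2 * c ^+ 2)]
   \/
   (0 < a * (1 + lambda * c * dt) /\ dt < - l / (a + lambda * c) ^+ 2)) ->
  exists2 rho : R, 0 <= rho < 1 & forall tau : R, 0 <= tau <= 1 ->
    (1 + a * tau * dt + c * (lambda * dt)) ^+ 2 + b ^+ 2 * dt
      + c ^+ 2 * (lambda * dt) <= rho.
Proof.
move=> l lam0 dt0 H.
(* For S = 0 the junk value A / 0 = 0 contradicts 0 < dt. *)
have dtS A S : 0 <= S -> dt < A / S -> dt * S < A.
  rewrite le0r => /predU1P[->|S0]; last by rewrite ltr_pdivlMr.
  by rewrite invr0 mulr0 ltNge ltW.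
pose K tau := (1 + a * tau * dt + c * (lambda * dt)) ^+ 2 + b ^+ 2 * dt
      + c ^+ 2 * (lambda * dt).
suff [rho rho1 Krho] : exists2 rho, rho < 1 &
    forall tau, 0 <= tau <= 1 -> K tau <= rho.
  (* Nonnegativity of [rho] is free: it bounds [K 1], a sum of nonnegative terms. *)
  exists rho => //; rewrite rho1 andbT; apply: le_trans (Krho 1 _).
    have lamdt := mulr_gt0 lam0 dt0.
    by rewrite /K !addr_ge0 ?sqr_ge0// mulr_ge0 ?sqr_ge0// ltW.
  by rewrite ler01 lexx.
have sub (A : R) : A < 0 -> 1 + dt * A < 1.
  by move=> A0; rewrite gtrDl pmulr_rlt0.
case: H => [[aneg la dtlt]|[apos dtlt]].
- have S0 : 0 <= a ^+ 2 + lambda ^+ 2 * c ^+ 2.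
    by rewrite addr_ge0 ?sqr_ge0// mulr_ge0 ?sqr_ge0.
  have h := dtS _ _ S0 dtlt.
  (* [K] with its nonpositive cross term dropped and [tau ^+ 2] replaced by 1. *)
  exists (1 + dt * (l - 2 * a + dt * (a ^+ 2 + lambda ^+ 2 * c ^+ 2))).
    by apply: sub; lra.
  move=> tau /andP[tau0 tau1]; rewrite -subr_ge0.
  rewrite (_ : _ - K tau = (1 - tau) * (1 + tau) * (a ^+ 2 * dt ^+ 2)
      + 2 * tau * dt * - (a * (1 + lambda * c * dt))); last first.
    by rewrite /K /l; ring.
  have a2 : 0 <= a ^+ 2 * dt ^+ 2 by rewrite mulr_ge0 ?sqr_ge0.
  apply: addr_ge0; first by apply: mulr_ge0 => //; apply: mulr_ge0; lra.
  by apply: mulr_ge0; [apply: mulr_ge0; lra|rewrite oppr_ge0].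
- have h := dtS _ _ (sqr_ge0 _) dtlt.
  (* This is [K 1]: the cross term is now nonnegative and largest at [tau = 1]. *)
  exists (1 + dt * (l + dt * (a + lambda * c) ^+ 2)).
    by apply: sub; lra.
  move=> tau /andP[tau0 tau1]; rewrite -subr_ge0.
  rewrite (_ : _ - K tau = (1 - tau) * (1 + tau) * (a ^+ 2 * dt ^+ 2)
      + 2 * (1 - tau) * dt * (a * (1 + lambda * c * dt))); last first.
    by rewrite /K /l; ring.
  have a2 : 0 <= a ^+ 2 * dt ^+ 2 by rewrite mulr_ge0 ?sqr_ge0.
  apply: addr_ge0; first by apply: mulr_ge0 => //; apply: mulr_ge0; lra.
  by apply: mulr_ge0; [apply: mulr_ge0; lra|exact: ltW].
Qed.

Section tamed_euler.
Context {d} {T : measurableType d} {R : realType} {P : probability T R}.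
Variables (a b c lambda alpha dt : R).
Variables (X0 : {RV P >-> R}) (W N : R -> {RV P >-> R}).
Hypotheses (lambda0 : 0 < lambda) (dt0 : 0 < dt).
Hypotheses (brownW : is_brownian_motion W) (poissonN : is_poisson_process lambda N).
Hypothesis (indep : independent_data X0 W N).

Let X := tamed_euler a b c alpha dt X0 (fun t => W t) (fun t => N t).
Let drift (x : R) := x + a * x * dt / (1 + dt `^ alpha * `|a * x|).

(** The two lengths are left free because the one-step identity uses both the past [(n.+1, n)] and
    the past [(n, n)]. *)
Lemma measurable_tamed_euler n n' m' : (n <= n')%N -> (n <= m')%N ->
  measurable_fun [set: g_sigma_algebraType (past_sets X0 W N dt n' m')] (X n).
Proof.
elim: n => [_ _|n IH nn' nm']; first exact: measurable_past_initial.
have mX := IH (ltnW nn') (ltnW nm').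
have mdrift : measurable_fun setT drift.
  by apply: measurable_tamed_drift; exact: powR_ge0.
apply: measurable_funD; first apply: measurable_funD.
- exact: measurableT_comp mdrift mX.
- apply: measurable_funM; first exact: measurable_funM.
  exact: measurable_past_W.
- apply: measurable_funM; first exact: measurable_funM.
  exact: measurable_past_N.
Qed.

Lemma measurable_tamed_eulerT n : measurable_fun [set: T] (X n).
Proof.
move=> mT B mB; rewrite setTI.
apply: (smallest_sub (@sigma_algebra_measurable _ T)
  (measurable_past_sets X0 W N dt n n)).
have := measurable_tamed_euler n n n (leqnn n) (leqnn n).
by move=> /(_ measurableT B mB); rewrite setTI.
Qed.

Lemma tamed_euler_second_moment_step n :
  (\int[P]_w (X n.+1 w ^+ 2)%:E
   = \int[P]_w ((drift (X n w) + c * X n w * (lambda * dt)) ^+ 2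
       + (b * X n w) ^+ 2 * dt + (c * X n w) ^+ 2 * (lambda * dt))%:E)%E.
Proof.
have [_ indepW _ _] := brownW; have [_ indepN lawN _] := poissonN.
have dt_ge0 := ltW dt0.
have t0 : 0 <= n%:R * dt by rewrite mulr_ge0.
have tS : n%:R * dt < n.+1%:R * dt by rewrite ltr_pM2r// ltr_nat.
have tE : n.+1%:R * dt - n%:R * dt = dt by rewrite -mulrBl -natrB// subSnn mul1r.
have mdrift : measurable_fun setT drift.
  by apply: measurable_tamed_drift; exact: powR_ge0.
pose DW := increment_RV W (n%:R * dt) (n.+1%:R * dt).
pose DN := increment_RV N (n%:R * dt) (n.+1%:R * dt).
have momW p q : (\int[P]_w ((p + q * DW w) ^+ 2)%:E
    = ((p + q * 0) ^+ 2 + q ^+ 2 * dt)%:E)%E.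
  by rewrite -[in RHS]tE; exact: integral_affine_sqr_brownian.
have momN p q : (\int[P]_w ((p + q * DN w) ^+ 2)%:E
    = ((p + q * (lambda * dt)) ^+ 2 + q ^+ 2 * (lambda * dt))%:E)%E.
  apply: integral_affine_sqr_poisson; first exact: mulr_gt0.
  by move=> k; rewrite -[in RHS]tE; exact: lawN.
have mXT := measurable_tamed_eulerT n.
transitivity (\int[P]_w
  ((drift (X n w) + b * X n w * DW w + c * X n w * DN w) ^+ 2)%:E)%E.
  by [].
have leSn : (n <= n.+1)%N by [].
have mX1 := measurable_tamed_euler n n.+1 n leSn (leqnn n).
have mX := measurable_tamed_euler n n n (leqnn n) (leqnn n).
(* The part free of [DN] contains [DW], so the past must hold [n.+1] increments of [W]. The Poisson
   mean and variance are both [lambda * dt]. *)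
rewrite (integral_affine_sqr_independent _ _ _ _ (past_sets X0 W N dt n.+1 n)
  _ _ DN (lambda * dt) (lambda * dt)) //; last 4 first.
- exact: measurable_past_sets.
- apply: measurable_funD; first exact: measurableT_comp mdrift mX1.
  apply: measurable_funM; first exact: measurable_funM.
  exact: measurable_past_W.
- exact: measurable_funM.
- exact: (past_independent_N X0 W N dt dt_ge0 indep indepN n.+1 n).
(* The Poisson variance term is split off to leave a square that is affine in [DW], and is added
   back after [DW] has been integrated out. *)
under eq_integral do rewrite EFinD.
rewrite ge0_integralD//; last 4 first.
- by move=> w _; rewrite lee_fin sqr_ge0.
- apply/measurable_EFinP/measurable_funX; apply: measurable_funD.
    apply: measurable_funD; first exact: measurableT_comp mdrift mXT.
    by apply: measurable_funM => //; exact: measurable_funM.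
  by apply: measurable_funM => //; exact: measurable_funM.
- by move=> w _; rewrite lee_fin mulr_ge0 ?sqr_ge0// mulr_ge0// ltW.
- apply/measurable_EFinP/measurable_funM => //.
  by apply: measurable_funX; exact: measurable_funM.
rewrite (_ : \int[P]_w ((drift (X n w) + b * X n w * DW w
    + c * X n w * (lambda * dt)) ^+ 2)%:E =
  \int[P]_w ((drift (X n w) + c * X n w * (lambda * dt)
    + b * X n w * DW w) ^+ 2)%:E)%E; last first.
  by apply: eq_integral => w _; rewrite addrAC.
rewrite (integral_affine_sqr_independent _ _ _ _ (past_sets X0 W N dt n n)
  _ _ DW 0 dt) //; last 4 first.
- exact: measurable_past_sets.
- apply: measurable_funD; first exact: measurableT_comp mdrift mX.
  by apply: measurable_funM => //; exact: measurable_funM.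
- exact: measurable_funM.
- exact: (past_independent_W X0 W N dt dt_ge0 indep indepW n n).
rewrite -ge0_integralD//; last 4 first.
- by move=> w _; rewrite lee_fin addr_ge0 ?sqr_ge0// mulr_ge0 ?sqr_ge0.
- apply/measurable_EFinP/measurable_funD.
    apply: measurable_funX; apply: measurable_funD.
      apply: measurable_funD; first exact: measurableT_comp mdrift mXT.
      by apply: measurable_funM => //; exact: measurable_funM.
    by apply: measurable_funM => //; exact: measurable_funM.
  apply: measurable_funM => //.
  by apply: measurable_funX; exact: measurable_funM.
- by move=> w _; rewrite lee_fin mulr_ge0 ?sqr_ge0// mulr_ge0// ltW.
- apply/measurable_EFinP/measurable_funM => //.
  by apply: measurable_funX; exact: measurable_funM.
by apply: eq_integral => w _; rewrite -EFinD mulr0 addr0.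
Qed.

(** With [tau] the taming factor at [x], the drift is [(1 + a * tau * dt) * x], so the integrand of
    the one-step identity is [x ^+ 2] times a factor bounded by [rho]. *)
Lemma tamed_euler_second_moment_le (rho : R) n : 0 <= rho ->
  (forall tau : R, 0 <= tau <= 1 ->
    (1 + a * tau * dt + c * (lambda * dt)) ^+ 2 + b ^+ 2 * dt
      + c ^+ 2 * (lambda * dt) <= rho) ->
  (\int[P]_w (X n.+1 w ^+ 2)%:E <= rho%:E * \int[P]_w (X n w ^+ 2)%:E)%E.
Proof.
move=> rho0 Krho; rewrite tamed_euler_second_moment_step.
have mXT := measurable_tamed_eulerT n.
have mdrift : measurable_fun setT drift.
  by apply: measurable_tamed_drift; exact: powR_ge0.
have ldt0 : 0 <= lambda * dt by rewrite mulr_ge0// ltW.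
rewrite -ge0_integralZl_EFin//; last 2 first.
- by move=> w _; rewrite lee_fin sqr_ge0.
- by apply/measurable_EFinP; exact: measurable_funX.
apply: ge0_le_integral => //.
- move=> w _; rewrite lee_fin !addr_ge0 ?sqr_ge0// mulr_ge0 ?sqr_ge0//.
  exact: ltW.
- apply/measurable_EFinP/measurable_funD.
    apply: measurable_funD.
      apply: measurable_funX; apply: measurable_funD.
        exact: measurableT_comp mdrift mXT.
      by apply: measurable_funM => //; exact: measurable_funM.
    apply: measurable_funM => //.
    by apply: measurable_funX; exact: measurable_funM.
  apply: measurable_funM => //.
  by apply: measurable_funX; exact: measurable_funM.
- apply: measurable_funeM.
  by apply/measurable_EFinP; exact: measurable_funX.
move=> w _; rewrite -EFinM lee_fin; set x := X n w.
set tau := (1 + dt `^ alpha * `|a * x|)^-1.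
have den1 : 1 <= 1 + dt `^ alpha * `|a * x|.
  by rewrite lerDl mulr_ge0// powR_ge0.
have tau01 : 0 <= tau <= 1.
  by rewrite invr_ge0 (le_trans ler01 den1)/= invf_le1// (lt_le_trans ltr01).
rewrite [leLHS](_ : _ = ((1 + a * tau * dt + c * (lambda * dt)) ^+ 2
    + b ^+ 2 * dt + c ^+ 2 * (lambda * dt)) * x ^+ 2); last first.
  by rewrite /drift -/tau; ring.
by rewrite ler_wpM2r ?sqr_ge0// Krho.
Qed.

End tamed_euler.

(** * Geometric decay of the second moment *)

Theorem theorem4p2 (d : measure_display) (T : measurableType d) (R : realType)
  (P : probability T R) (a b c lambda alpha dt : R)
  (X0 : {RV P >-> R}) (W N : R -> {RV P >-> R}) :
  let l := 2 * a + b ^+ 2 + lambda * c * (2 + c) in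
  0 < lambda -> 0 <= alpha <= 1 -> 0 < dt -> l < 0 ->
  is_brownian_motion W ->
  is_poisson_process lambda N ->
  independent_data X0 W N ->
  ('E_P[(fun w => `|X0 w| ^+ 2)%R] < +oo)%E ->
  ([/\ a * (1 + lambda * c * dt) <= 0, 0 < 2 * a - l
     & dt < (2 * a - l) / (a ^+ 2 + lambda ^+ 2 * c ^+ 2)]
   \/
   (0 < a * (1 + lambda * c * dt) /\ dt < - l / (a + lambda * c) ^+ 2)) ->
  mean_square_stable P
    (tamed_euler a b c alpha dt X0 (fun t => W t) (fun t => N t)).
Proof.
move=> l lambda0 _ dt0 _ brownW poissonN indep EX0 dt_small.
have [rho /andP[rho0 rho1] Krho] :=
  tamed_growth_factor R a b c lambda dt lambda0 dt0 dt_small.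
rewrite /mean_square_stable; set X := tamed_euler _ _ _ _ _ _ _ _.
rewrite unlock.
have I0 n : (0 <= \int[P]_w (X n w ^+ 2)%:E)%E.
  by apply: integral_ge0 => w _; rewrite lee_fin sqr_ge0.
(* Square integrability of [X0] makes the starting value real, so that [r * rho ^+ n] tends to 0. *)
have [r rE] : exists r : R, (\int[P]_w (X 0%N w ^+ 2)%:E = r%:E)%E.
  exists (fine (\int[P]_w (X 0%N w ^+ 2)%:E))%E.
  rewrite fineK// ge0_fin_numE//; move: EX0; rewrite unlock.
  by under eq_integral do rewrite real_normK ?num_real//.
apply: (@squeeze_cvge _ _ _ _ (cst 0%E) _ (fun n => (r * rho ^+ n)%:E)).
- apply: nearW; elim=> [|n IH]; rewrite I0/=; first by rewrite expr0 mulr1 rE.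
  apply: (le_trans (tamed_euler_second_moment_le a b c lambda alpha dt X0 W N
    lambda0 dt0 brownW poissonN indep rho n rho0 Krho)).
  rewrite exprS mulrCA EFinM; apply: lee_wpmul2l; first by rewrite lee_fin.
  by have /andP[] := IH.
- exact: cvg_cst.
- apply: cvg_EFin; first exact: nearW.
  by apply: cvg_geometric; rewrite ger0_norm.
Qed.
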